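(* Let $\alpha>-1$ and $M\ge0$. Let $c_0$ be the linear functional associated to $x^{\alpha}e^{-x}dx$ on $]0,+\infty[$, and let $c_1$ be the one associated to $\frac{x^{\alpha+1}}{x-\xi}e^{-x}dx+M\delta(\xi)$ with $\xi=0$, that is, $c_1(p)=\int_0^\infty p(x)x^{\alpha}e^{-x}dx+Mp(0)$. Let $\mu_{1,n}$ be the smallest zero of the polynomial $A_n(\lambda)$ associated with the coherent pair $(c_0,c_1)$. Then $$\lim_{n\to\infty}\mu_{1,n}=0.$$
   Context: Let $P_n$ (resp. $T_n$) be the monic orthogonal polynomials with respect to $c_0$ (resp. $c_1$), $k_n^{(0)}=c_0(P_n^2)$, $k_n^{(1)}=c_1(T_n^2)$. The pair is coherent: there are real numbers $\sigma_n$, $n\ge1$, with $T_n=\frac{P_{n+1}'}{n+1}-\sigma_n\frac{P_n'}{n}$. The polynomials $A_n$ are defined by $A_0(\lambda)=1$, $A_1(\lambda)=\lambda-\frac{k_1^{(0)}}{k_0^{(1)}}$ and, for $n\ge2$, $$A_n(\lambda)=\Big(\lambda-\frac{k_n^{(0)}}{n^2k_{n-1}^{(1)}}-\frac{\sigma_{n-1}^2}{(n-1)^2}\frac{k_{n-1}^{(0)}}{k_{n-1}^{(1)}}\Big)A_{n-1}(\lambda)-\frac{\sigma_{n-1}^2(k_{n-1}^{(0)})^2}{(n-1)^4k_{n-1}^{(1)}k_{n-2}^{(1)}}A_{n-2}(\lambda).$$ Their zeros are real and positive. The number $\mu_{1,n}$ arises from the Markov-Bernstein inequality $c_1((p')^2)\le\frac{1}{\mu_{1,n}}c_0(p^2)$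 for real polynomials $p$ of degree at most $n$. *)

(* Defs.v *)
From HB Require Import structures.
From mathcomp Require Import all_boot all_order all_algebra.
From mathcomp Require Import all_classical all_reals all_analysis.

Set Implicit Arguments.
Unset Strict Implicit.
Unset Printing Implicit Defensive.

Import Order.TTheory GRing.Theory Num.Theory.
Import numFieldNormedType.Exports.

Local Open Scope classical_set_scope.
Local Open Scope ring_scope.

Definition laguerre_functional (R : realType) (alpha : R) (p : {poly R}) : R :=
  \int[lebesgue_measure]_(x in `]0, +oo[%classic)
    (p.[x] * (x `^ alpha * expR (- x))).

(* For xi = 0 the absolutely continuous part x^(alpha+1)/(x - xi) e^(-x) dx is
   x^alpha e^(-x) dx on ]0, +oo[, so only the mass at 0 is added. *)
Definition laguerre_mass_functional (R : realType) (alpha M : R)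
    (p : {poly R}) : R :=
  (\int[lebesgue_measure]_(x in `]0, +oo[%classic)
     (p.[x] * (x `^ alpha * expR (- x)))) + M * p.[0].

Definition monic_orthogonal (R : realType) (c : {poly R} -> R)
    (P : nat -> {poly R}) : Prop :=
  [/\ forall n, P n \is monic /\ size (P n) = n.+1,
      forall n, c (P n ^+ 2) != 0
    & forall m n, m != n -> c (P m * P n) = 0].

Definition coherent (R : realType) (P T : nat -> {poly R})
    (sigma : nat -> R) : Prop :=
  forall n, (1 <= n)%N ->
    T n = (n.+1%:R)^-1 *: (P n.+1)^`() - (sigma n / n%:R) *: (P n)^`().

(* The last clause is the recurrence for A_n with n = m + 2. *)
Fixpoint MB_poly (R : realType) (k0 k1 sigma : nat -> R) (n : nat)
    : {poly R} :=
  match n with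
  | 0 => 1
  | 1 => 'X - (k0 1%N / k1 0%N)%:P
  | (m.+1 as m1).+1 =>
      ('X - (k0 m.+2 / (m.+2%:R ^+ 2 * k1 m.+1))%:P
          - (sigma m.+1 ^+ 2 / m.+1%:R ^+ 2 * (k0 m.+1 / k1 m.+1))%:P)
        * MB_poly k0 k1 sigma m1
      - (sigma m.+1 ^+ 2 * k0 m.+1 ^+ 2
          / (m.+1%:R ^+ 4 * k1 m.+1 * k1 m)) *: MB_poly k0 k1 sigma m
  end.

Definition smallest_root (R : realType) (p : {poly R}) (x : R) : Prop :=
  root p x /\ forall y, root p y -> x <= y.

(* Main.v *)
Require Import Defs.
From HB Require Import structures.
From mathcomp Require Import all_boot all_order all_algebra.
From mathcomp Require Import all_classical all_reals all_analysis.
From mathcomp Require Import measurable_realfun ring lra.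

Import Order.TTheory GRing.Theory Num.Theory.
Import numFieldNormedType.Exports.

Local Open Scope classical_set_scope.
Local Open Scope ring_scope.

(**
Let D_n(x) = (-1)^n A_n(x).  The A_n are the characteristic polynomials of the
Jacobi matrices of the form c_0(p^2) in a basis orthonormal for c_1((p')^2),
and D_n(x) / D_{n-1}(x) are the pivots of the matrix shifted by x.  Below the
smallest zero all pivots are positive, and bounding them by induction gives
mu_{1,n} c_1((P_n')^2) <= c_0(P_n^2), i.e. the Markov-Bernstein inequality
tested on p = P_n.

Since M >= 0, c_1((P_n')^2) >= c_0((P_n')^2).  The Pearson equation
c_0(x p') = c_0(x p) - (alpha + 1) c_0(p) makes the Laguerre operator
q |-> x q'' + (alpha + 1 - x) q' symmetric for c_0, and pairing it with P_n and
P_n' yields (alpha + 1) c_0((P_n')^2) = n c_0(P_n^2).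
Hence 0 < mu_{1,n} <= (alpha + 1) / n.
*)

(** * Orthogonality and the Laguerre operator for an abstract linear functional *)

Section Functional.
Context {R : realType} (c : {scalar {poly R}}).
Implicit Types p q : {poly R}.

Lemma orthogonal_lower_size (P : nat -> {poly R}) n q :
  monic_orthogonal c P -> (size q <= n)%N -> c (P n * q) = 0.
Proof.
move=> [Pmonic _ Porth].
suff H m : (m <= n)%N -> forall q, (size q <= m)%N -> c (P n * q) = 0.
  exact: H.
elim: m => [_ {}q|m IH mn {}q sq].
  by rewrite leqn0 size_poly_eq0 => /eqP ->; rewrite mulr0 linear0.
have [Pm sPm] := Pmonic m.
have -> : P n * q = P n * (q - q`_m *: P m) + q`_m *: (P n * P m).
  by rewrite -!mul_polyC; ring.
rewrite linearD [c (_ *: _)]linearZ /= Porth ?gtn_eqF// mulr0 addr0.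
apply: IH; first exact: ltnW.
apply/leq_sizeP => j; rewrite leq_eqVlt => /predU1P[<-|mj].
  move/monicP: Pm; rewrite lead_coefE sPm coefB coefZ => /= ->.
  by rewrite mulr1 subrr.
rewrite coefB coefZ [q`_j]nth_default ?(leq_trans sq)//.
by rewrite [(P m)`_j]nth_default ?sPm// mulr0 subrr.
Qed.

Definition laguerre_op (b : R) q := 'X * q^`()^`() + (b%:P - 'X) * q^`().

Lemma coef_laguerre_op b q j :
  (laguerre_op b q)`_j = j.+1%:R * (j%:R + b) * q`_j.+1 - j%:R * q`_j.
Proof.
rewrite /laguerre_op mulrBl coefD coefB !coefXM coefCM !coef_deriv.
by case: j => [|j] /=; rewrite ?mul0r; ring.
Qed.

Lemma size_laguerre_op b q : (size (laguerre_op b q) <= size q)%N.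
Proof.
apply/leq_sizeP => j jq; rewrite coef_laguerre_op.
by rewrite !nth_default ?mulr0 ?subrr// ltnW.
Qed.

(** On degree [n] the operator multiplies the leading coefficient by [- n], so adding [n%:R *: p]
    cancels it. *)
Lemma size_laguerre_op_eigen b p n : size p = n.+1 ->
  (size (laguerre_op b p + n%:R *: p)%R <= n)%N.
Proof.
move=> sp; apply/leq_sizeP => j; rewrite leq_eqVlt coefD coefZ coef_laguerre_op.
have pj1 k : (n <= k)%N -> p`_k.+1 = 0 by move=> ?; rewrite nth_default ?sp.
case/predU1P => [<-|nj]; first by rewrite pj1//; ring.
by rewrite pj1 1?ltnW// [p`_j]nth_default ?sp//; ring.
Qed.

Section Pearson.
Variable b : R.
Hypothesis pearson : forall p, c ('X * p^`()) = c ('X * p) - b * c p.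

Lemma laguerre_op_green p q :
  c (q * laguerre_op b p) = - c ('X * p^`() * q^`()).
Proof.
have := pearson (p^`() * q); rewrite derivM.
have -> : q * laguerre_op b p =
    'X * (p^`()^`() * q + p^`() * q^`()) - 'X * p^`() * q^`()
    + b *: (p^`() * q) - 'X * (p^`() * q).
  by rewrite /laguerre_op -mul_polyC; ring.
by rewrite linearB linearD linearB [c (b *: _)]linearZ /= => ->; ring.
Qed.

Lemma laguerre_op_sym p q : c (q * laguerre_op b p) = c (p * laguerre_op b q).
Proof. by rewrite !laguerre_op_green mulrAC. Qed.

(** Pairing [p] with [laguerre_op b p + n%:R *: p] gives [e1]. Pairing it with the image of
    [p^]()[and using symmetry gives]e2[, that is]c (x p' p'') =
    0[. The Pearson equation for the square of]p^[()] combines the two. *)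
Lemma laguerre_deriv_norm p n : size p = n.+1 ->
  (forall q, (size q <= n)%N -> c (p * q) = 0) ->
  b * c (p^`() ^+ 2) = n%:R * c (p ^+ 2).
Proof.
move=> sp orth.
have sp' : (size p^`() <= n)%N.
  by rewrite -ltnS -sp lt_size_deriv// -size_poly_gt0 sp.
have e1 : c ('X * p^`() ^+ 2) = n%:R * c (p ^+ 2).
  have := orth _ (size_laguerre_op_eigen b p n sp).
  rewrite mulrDr linearD /= laguerre_op_green -scalerAr linearZ /= -!expr2.
  by rewrite -mulrA -expr2 => /eqP; rewrite addrC subr_eq0 => /eqP ->.
have := orth _ (leq_trans (size_laguerre_op b _) sp').
rewrite laguerre_op_sym laguerre_op_green => /eqP; rewrite oppr_eq0 => /eqP e2.
have := pearson (p^`() * p^`()); rewrite derivM -!expr2 e1.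
have -> : 'X * (p^`()^`() * p^`() + p^`() * p^`()^`())
          = 2 *: ('X * p^`() * p^`()^`()) :> {poly R}.
  by rewrite -mul_polyC; ring.
by rewrite linearZ /= e2 mulr0 => /eqP; rewrite eq_sym subr_eq0 => /eqP.
Qed.
End Pearson.
End Functional.

(** * Sign analysis of the three-term recurrence and bounds on the smallest zero *)

Section Recurrence.
Context {R : realType} (k0 k1 sigma : nat -> R).
Hypotheses (k0_gt0 : forall n, 0 < k0 n) (k1_gt0 : forall n, 0 < k1 n).

Let A n : {poly R} := MB_poly k0 k1 sigma n.
Let D n (x : R) : R := (-1) ^+ n * (A n).[x].
(** In the application this is [c0 ((P_n / n) ^ 2)], the counterpart of [w n] below. *)
Let q n := k0 n / n%:R ^+ 2.

Let q_gt0 n : 0 < q n.+1.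
Proof. by rewrite divr_gt0// exprn_gt0. Qed.

Let D0 x : D 0%N x = 1. Proof. by rewrite /D /= mul1r hornerC. Qed.

Let D1 x : k1 0%N * D 1%N x = q 1%N - x * k1 0%N.
Proof.
rewrite /D /q /= hornerXsubC; field.
by rewrite gt_eqF.
Qed.

Let DS m x : k1 m.+1 * D m.+2 x =
  (q m.+2 + sigma m.+1 ^+ 2 * q m.+1 - x * k1 m.+1) * D m.+1 x
  - sigma m.+1 ^+ 2 * q m.+1 ^+ 2 * (D m x / k1 m).
Proof.
rewrite /D -[A m.+2]/(('X - (k0 m.+2 / (m.+2%:R ^+ 2 * k1 m.+1))%:P
          - (sigma m.+1 ^+ 2 / m.+1%:R ^+ 2 * (k0 m.+1 / k1 m.+1))%:P)
        * A m.+1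
      - (sigma m.+1 ^+ 2 * k0 m.+1 ^+ 2
          / (m.+1%:R ^+ 4 * k1 m.+1 * k1 m)) *: A m).
rewrite hornerD hornerN hornerZ hornerM !hornerD !hornerN !hornerC hornerX
  /q !exprS; field.
by rewrite !gt_eqF ?k1_gt0.
Qed.

(** The lower bound on the ratio of consecutive [D] is what makes positivity inductive. *)
Let D_le0 m x : x <= 0 -> 0 < D m x /\ q m.+1 * D m x <= k1 m * D m.+1 x.
Proof.
move=> x0; elim: m => [|m [Dm IH]].
  rewrite D0 D1; split => //.
  by rewrite mulr1 lerBrDr gerDl mulr_le0_ge0// ltW.
have Dm1 : 0 < D m.+1 x.
  by rewrite -(pmulr_rgt0 _ (k1_gt0 m)) (lt_le_trans _ IH)// mulr_gt0.
split => //; rewrite DS -subr_ge0.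
(* The first summand is nonnegative by the induction hypothesis, the second because [x <= 0]. *)
have -> : (q m.+2 + sigma m.+1 ^+ 2 * q m.+1 - x * k1 m.+1) * D m.+1 x -
    sigma m.+1 ^+ 2 * q m.+1 ^+ 2 * (D m x / k1 m) - q m.+2 * D m.+1 x
  = sigma m.+1 ^+ 2 * q m.+1 * (D m.+1 x - q m.+1 * D m x / k1 m)
    + (- x) * k1 m.+1 * D m.+1 x by ring.
apply: addr_ge0.
  apply: mulr_ge0; first exact: mulr_ge0 (sqr_ge0 _) (ltW (q_gt0 _)).
  by rewrite subr_ge0 ler_pdivrMr// [leRHS]mulrC.
by rewrite mulr_ge0 ?(ltW Dm1)// mulr_ge0 ?oppr_ge0 ?(ltW (k1_gt0 _)).
Qed.

Variable mu : nat -> R.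
Hypothesis hmu : forall n, (0 < n)%N -> smallest_root (A n) (mu n).

Lemma smallest_root_gt0 n : (0 < n)%N -> 0 < mu n.
Proof.
move=> /hmu[/rootP r _]; rewrite ltNge; apply/negP => /(D_le0 n)[+ _].
by rewrite /D r mulr0 ltxx.
Qed.

Let mu_le n x : (0 < n)%N -> D n x <= 0 -> mu n <= x.
Proof.
move=> n0 Dx; have [_ hmin] := hmu n n0.
have x0 : 0 <= x.
  by rewrite leNgt; apply/negP => /ltW /(D_le0 n)[]; rewrite ltNge Dx.
have [D0n _] := D_le0 n 0 (lexx _).
(* [D n] is positive at 0 and nonpositive at [x]; the intermediate value theorem expects the
   opposite signs, hence the extra minus. *)
have HD y : D n y = - (- ((-1) ^+ n) *: A n).[y] by rewrite hornerZ mulNr opprK.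
have [||y /andP[_ yx]] := @poly_ivt _ (- ((-1) ^+ n) *: A n) 0 x.
- by [].
- by rewrite -oppr_ge0 -HD ltW//= -oppr_le0 -HD.
- by rewrite rootZ ?oppr_eq0 ?signr_eq0// => /hmin /le_trans; apply.
Qed.

Let D_gt0 n x : (0 < n)%N -> x < mu n -> 0 < D n x.
Proof. by move=> n0; rewrite !ltNge; apply: contra => /(mu_le n x n0). Qed.

Let D_mu n : (0 < n)%N -> D n (mu n) = 0.
Proof. by move=> /hmu[/rootP r _]; rewrite /D r mulr0. Qed.

(** At a zero of [D k.+1] only the last term of the recurrence survives, so [D k.+2] has the sign
    opposite to [D k] or vanishes. Consequently every [D j] with [j <= n] is positive below
    [mu n]. *)
Lemma smallest_root_nonincreasing m n : (0 < m)%N -> (m <= n)%N -> mu n <= mu m.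
Proof.
have step k : mu k.+2 <= mu k.+1.
  elim: k => [|k IH]; apply: mu_le => //.
    rewrite -(pmulr_rle0 _ (k1_gt0 1)) DS D_mu// mulr0 sub0r oppr_le0 D0.
    apply: mulr_ge0; first exact: mulr_ge0 (sqr_ge0 _) (sqr_ge0 _).
    by rewrite divr_ge0// ltW.
  rewrite -(pmulr_rle0 _ (k1_gt0 k.+2)) DS D_mu// mulr0 sub0r oppr_le0.
  apply: mulr_ge0; first exact: mulr_ge0 (sqr_ge0 _) (sqr_ge0 _).
  apply: divr_ge0 (ltW (k1_gt0 _)).
  move: IH; rewrite le_eqVlt => /predU1P[->|/D_gt0/ltW]; last exact.
  by rewrite D_mu.
case: m => // m _; elim: n => // n IH; rewrite leq_eqVlt => /predU1P[<-//|mn].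
by rewrite (le_trans _ (IH mn))//; case: n mn {IH} => // n _; exact: step.
Qed.

(* [w n] stands for [c1 ((P_n' / n) ^ 2)]. *)
Variable w : nat -> R.
Hypotheses (w1 : w 1%N = k1 0%N)
  (wS : forall m, w m.+2 = k1 m.+1 + sigma m.+1 ^+ 2 * w m.+1).

Let w_gt0 n : 0 < w n.+1.
Proof.
by elim: n => [|n IH]; rewrite ?w1// wS ltr_pwDl// mulr_ge0 ?sqr_ge0// ltW.
Qed.

(** The upper bound on the pivot is the form [c0 (p ^ 2) - x c1 (p' ^ 2)] evaluated at
    [p = P_(n+1) / (n+1)]. *)
Let D_ratio_le x n : 0 <= x -> (forall j, (j <= n.+1)%N -> 0 <= D j x) ->
  k1 n * D n.+1 x <= (q n.+1 - x * w n.+1) * D n x.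
Proof.
move=> x0; elim: n => [|n IH] D_ge0; first by rewrite D0 D1 w1 mulr1.
have {}IH := IH (fun j jn => D_ge0 j (leqW jn)).
have Dn : 0 <= D n x by rewrite D_ge0// ltnW// ltnW.
have xw0 : 0 <= x * w n.+1 by rewrite mulr_ge0// ltW.
(* Multiplying the induction hypothesis by [q + x w] produces [q ^ 2 - (x w) ^ 2], which is at most
   [q ^ 2]. *)
have E : (q n.+1 + x * w n.+1) * D n.+1 x <= q n.+1 ^+ 2 * (D n x / k1 n).
  rewrite mulrA ler_pdivlMr// -mulrA [D n.+1 x * _]mulrC.
  have qxw : 0 <= q n.+1 + x * w n.+1 by rewrite addr_ge0// ltW.
  apply: le_trans (ler_wpM2l qxw IH) _; rewrite mulrA ler_wpM2r//.
  by rewrite mulrC -subr_sqr gerBl sqr_ge0.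
rewrite DS wS -subr_ge0.
have -> : (q n.+2 - x * (k1 n.+1 + sigma n.+1 ^+ 2 * w n.+1)) * D n.+1 x -
    ((q n.+2 + sigma n.+1 ^+ 2 * q n.+1 - x * k1 n.+1) * D n.+1 x -
     sigma n.+1 ^+ 2 * q n.+1 ^+ 2 * (D n x / k1 n))
  = sigma n.+1 ^+ 2 * (q n.+1 ^+ 2 * (D n x / k1 n)
      - (q n.+1 + x * w n.+1) * D n.+1 x) by ring.
by rewrite mulr_ge0 ?sqr_ge0// subr_ge0.
Qed.

Lemma smallest_root_mul_le n : mu n.+1 * w n.+1 <= k0 n.+1 / n.+1%:R ^+ 2.
Proof.
rewrite -/(q _) leNgt; apply/negP; rewrite -ltr_pdivrMr// => xmu.
(* At this [x] the pivot bound is exactly 0, which contradicts positivity below the smallest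
   zero. *)
set x := _ / _ in xmu.
have D_gt0x j : (j <= n.+1)%N -> 0 < D j x.
  case: j => [|j jn]; first by rewrite D0.
  by rewrite D_gt0// (lt_le_trans xmu)// smallest_root_nonincreasing.
have x0 : 0 <= x by rewrite divr_ge0// ltW.
have := D_ratio_le x n x0 (fun j jn => ltW (D_gt0x j jn)).
by rewrite divfK ?gt_eqF// subrr mul0r pmulr_rle0// leNgt D_gt0x.
Qed.
End Recurrence.

(** * Moments of the Laguerre weight and their recursion *)

Section Moments.
Context {R : realType} (alpha : R).
Local Notation leb := (@lebesgue_measure R).

Definition laguerre_monomial (j : nat) (x : R) : R :=
  x ^+ j * (x `^ alpha * expR (- x)).
Local Notation w := laguerre_monomial.

Lemma laguerre_monomial_ge0 j x : 0 <= x -> 0 <= w j x.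
Proof. by move=> x0; rewrite !mulr_ge0 ?exprn_ge0 ?powR_ge0 ?expR_ge0. Qed.

Lemma is_derive_laguerre_monomial (j : nat) (x : R) : 0 < x ->
  is_derive x 1 (w j) ((j%:R + alpha) / x * w j x - w j x).
Proof.
move=> x0.
rewrite [X in is_derive _ _ X](_ : w j =
  (fun y : R => y ^+ j) * ((fun y : R => y `^ alpha) * (fun y => expR (- y))))//.
have de : is_derive x 1 (fun y : R => expR (- y)) (- expR (- x)).
  by apply: is_derive_eq; rewrite ?scaleN1r ?mulrN1.
have dp := is_derive1_powR alpha x0.
have dj : is_derive x 1 (fun y : R => y ^+ j) (j%:R * x ^+ j.-1).
  by apply: DeriveDef; [exact: exprn_derivable|
    rewrite exp_derive; exact: mulr1].
have pE : x `^ (alpha - 1) = x `^ alpha / x.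
  by rewrite powRB ?(gt_eqF x0) ?implybT// powRr1// ltW.
apply: is_derive_eq; rewrite /= /GRing.scale fctE /= pE.
case: j {dj} => [|j]; rewrite /w ?exprS /=; field; by rewrite gt_eqF.
Qed.


Lemma continuous_laguerre_monomial j (a b : R) : 0 < a ->
  {within `[a, b], continuous (laguerre_monomial j)}.
Proof.
move=> a0; apply: derivable_within_continuous => x.
rewrite in_itv /= => /andP[ax _].
by have [] := is_derive_laguerre_monomial j x (lt_le_trans a0 ax).
Qed.

Lemma measurable_laguerre_monomial j (D : set R) : measurable D ->
  measurable_fun D (w j).
Proof.
move=> mD; apply: measurable_funM; first exact: exprn_measurable.
apply: measurable_funM.
  apply: measurable_funTS. exact: measurable_powR.
by apply: measurable_funTS; apply: measurableT_comp.
Qed.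

(** The derivative of [w j.+1] is [(j + 1 + alpha) w j - w j.+1]. The condition [0 < a] keeps away
    from a possible singularity at 0. *)
Lemma laguerre_monomial_FTC j (a b : R) : 0 < a -> a < b ->
  ((j.+1%:R + alpha)%:E * \int[leb]_(x in `[a, b]) (w j x)%:E =
   \int[leb]_(x in `[a, b]) (w j.+1 x)%:E + (w j.+1 b - w j.+1 a)%:E)%E.
Proof.
move=> a0 ab.
have iw i : leb.-integrable `[a, b] (EFin \o w i).
  apply: continuous_compact_integrable; first exact: segment_compact.
  exact: continuous_laguerre_monomial.
have dw x : a <= x -> 
    is_derive x 1 (w j.+1) ((j.+1%:R + alpha) * w j x - w j.+1 x).
  move=> ax; have x0 := lt_le_trans a0 ax.
  apply: is_derive_eq (is_derive_laguerre_monomial j.+1 x x0) _.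
  by rewrite /w exprS; field; rewrite gt_eqF.
have cw i x : a <= x -> w i y @[y --> x] --> w i x.
  move=> ax; apply/differentiable_continuous/derivable1_diffP.
  by have [] := is_derive_laguerre_monomial i x (lt_le_trans a0 ax).
have := @continuous_FTC2 R (fun x => (j.+1%:R + alpha) * w j x - w j.+1 x)
  (w j.+1) a b ab.
rewrite EFinB => <-.
- under [X in (_ + X)%E]eq_integral do rewrite EFinB EFinM.
  rewrite integralB//=; [|apply: integrableZl => //; exact: iw|exact: iw].
  rewrite integralZl//; last exact: iw.
  by rewrite addeC subeK//; apply: (integrable_fin_num _ (iw j.+1)).
- move=> x; apply: cvgB; last exact: continuous_laguerre_monomial.
  by apply: cvgM; [exact: cvg_cst|exact: continuous_laguerre_monomial].
- split.
  + by move=> x; rewrite in_itv /= => /andP[/ltW /dw[]].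
  + exact/cvg_at_right_filter/cw.
  + exact/cvg_at_left_filter/cw/ltW.
- by move=> x; rewrite in_itv /= => /andP[/ltW /dw[? <-] _]; rewrite derive1E.
Qed.

(** The index [j.+1] makes the exponent [j + 1 + alpha] positive, and the exponential factor is at
    most 1. *)
Lemma cvg_laguerre_monomial_0 j : -1 < alpha ->
  w j.+1 n.+2%:R^-1 @[n --> \oo] --> (0 : R).
Proof.
move=> halpha; have a0 : 0 < j.+1%:R + alpha.
  by rewrite -natr1; have := ler0n R j; lra.
have /cvg_at_rightP := powR_cvg0 a0.
move=> /(_ (fun n => n.+2%:R^-1)) H.
apply: (squeeze_cvgr _ (cvg_cst 0) (H _)); last first.
  split => [n|]; first by rewrite invr_gt0.
  by rewrite (cvg_shiftS (fun n => n.+1%:R^-1 : R)); exact: cvg_harmonic.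
near=> n; set x := _^-1; have x0 : 0 < x by rewrite invr_gt0.
rewrite (laguerre_monomial_ge0 _ _ (ltW x0)) /=.
rewrite powRD ?(gt_eqF x0) ?implybT// powR_mulrn ?(ltW x0)// /w.
rewrite ler_pM2l ?exprn_gt0//.
by rewrite ler_piMr ?powR_ge0// -[leRHS]expR0 ler_expR oppr_le0 ltW.
Unshelve. all: by end_near. Qed.

Lemma cvg_laguerre_monomial_y j : w j n.+2%:R @[n --> \oo] --> (0 : R).
Proof.
(* Bounding [alpha] by [m + 1] replaces the real power by an integer one; the exponential series
   then supplies one further power of [x], with constant [C]. *)
pose m := Num.truncn `|alpha|.
have am : alpha <= m.+1%:R.
  by rewrite (le_trans (ler_norm _))// ltW// truncnS_gt.
pose C : R := (j + m.+1).+1`!%:R.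
have : C * n.+1%:R^-1 @[n --> \oo] --> C * 0.
  by apply: cvgM; [exact: cvg_cst|exact: cvg_harmonic].
rewrite mulr0; apply: squeeze_cvgr (cvg_cst 0); near=> n.
rewrite laguerre_monomial_ge0//=; set x := n.+2%:R.
have x1 : 1 <= x by rewrite ler1n.
have x0 : 0 < x by rewrite (lt_le_trans ltr01).
apply: (@le_trans _ _ (C / x)); last first.
  by rewrite ler_pM2l ?ltr0n ?fact_gt0// lef_pV2 ?posrE// ler_nat.
rewrite /w mulrA expRN ler_pdivrMr ?expR_gt0//.
apply: (@le_trans _ _ (x ^+ (j + m.+1))).
  by rewrite exprD ler_pM2l ?exprn_gt0// -powR_mulrn ?(ltW x0)// ler_powR.
have C0 : 0 < C by rewrite ltr0n fact_gt0.
have -> : x ^+ (j + m.+1) = C / x * (x ^+ (j + m.+1).+1 / C).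
  by rewrite exprS; field; rewrite !gt_eqF.
rewrite ler_pM2l ?divr_gt0//.
by apply: le_trans (expR_ge1Dxn (j + m.+1) (ltW x0)); rewrite lerDr.
Unshelve. all: by end_near. Qed.

Lemma bigcup_itv_pos :
  \bigcup_n `[n.+2%:R^-1, n.+2%:R]%classic = `]0 : R, +oo[%classic.
Proof.
apply/seteqP; split => [x [n _] /=|x /=]; rewrite !in_itv /= ?andbT.
  by move=> /andP[+ _]; apply: lt_le_trans; rewrite invr_gt0.
(* This index bounds [x] and its inverse simultaneously. *)
move=> x0; exists (Num.truncn (x + x^-1)) => //=; rewrite in_itv /=.
have xV0 : 0 < x^-1 by rewrite invr_gt0.
have : x + x^-1 < (Num.truncn (x + x^-1)).+2%:R.
  by rewrite (lt_trans (truncnS_gt _))// ltr_nat.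
set n := _.+2 => H; rewrite -[leRHS]invrK lef_pV2 ?posrE ?invr_gt0//.
by apply/andP; split; lra.
Qed.

(* The recursion Gamma(s + 1) = s Gamma(s), with s = j + 1 + alpha > 0. *)
Lemma laguerre_moment_rec j : -1 < alpha ->
  ((j.+1%:R + alpha)%:E * \int[leb]_(x in `]0%R, +oo[) (w j x)%:E =
   \int[leb]_(x in `]0%R, +oo[) (w j.+1 x)%:E)%E.
Proof.
move=> halpha; pose S (n : nat) := `[n.+2%:R^-1 : R, n.+2%:R]%classic.
(* Monotone convergence for a nonnegative integrand: the identity is obtained in the extended reals,
   before any moment is known to be finite. *)
have cvgS i : (\int[leb]_(x in S n) (w i x)%:E @[n --> \oo] -->
    \int[leb]_(x in `]0%R, +oo[) (w i x)%:E)%E.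
  rewrite -bigcup_itv_pos; apply: ge0_nondecreasing_set_cvg_integral.
  - move=> m n mn; apply/subsetPset => x.
    rewrite /S /= !in_itv /= => /andP[h1 h2].
    rewrite (le_trans _ h1) ?(le_trans h2) ?ler_nat//.
    by rewrite lef_pV2 ?posrE// ler_nat.
  - by move=> n; exact: measurable_itv.
  - move=> n; have mS : measurable (S n) by exact: measurable_itv.
    exact: (measurable_EFinP _ _).2 (measurable_laguerre_monomial i _ mS).
  - move=> n x; rewrite /S /= in_itv /= => /andP[h _].
    by rewrite lee_fin laguerre_monomial_ge0// (le_trans _ h)// invr_ge0 ler0n.
have c1 := cvgeZl (erefl : (j.+1%:R + alpha)%:E \is a fin_num) (cvgS j).
have r0 :
    (w j.+1 n.+2%:R - w j.+1 n.+2%:R^-1)%:E @[n --> \oo] --> (0%E : \bar R).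
  apply: cvg_EFin; first by near=> n.
  rewrite -[0]subr0; apply: cvgB; first exact: cvg_laguerre_monomial_y.
  exact: cvg_laguerre_monomial_0.
have c2 :=
  cvgeD (fin_num_adde_defl _ (erefl : 0%:E \is a fin_num)) (cvgS j.+1) r0.
rewrite adde0 in c2.
have e : (fun n => (j.+1%:R + alpha)%:E * \int[leb]_(x in S n) (w j x)%:E)%E =
    (fun n => \int[leb]_(x in S n) (w j.+1 x)%:E)%E
    \+ (fun n => (w j.+1 n.+2%:R - w j.+1 n.+2%:R^-1)%:E)%E.
  apply/funext => n; apply: laguerre_monomial_FTC; rewrite ?invr_gt0//.
  by rewrite (@lt_trans _ _ 1) ?ltr1n// invf_lt1 ?ltr1n.
rewrite e in c1; by apply: cvg_unique c1 (c2 _).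
Unshelve. all: by end_near. Qed.
End Moments.

(** * Integrability, linearity and the Pearson equation for the Laguerre functional *)

Section MomentFunctional.
Context {R : realType} (alpha : R).
Hypothesis halpha : -1 < alpha.
Local Notation leb := (@lebesgue_measure R).
Local Notation w := (laguerre_monomial alpha).
Hypothesis weight_fin :
  (\int[leb]_(x in `]0%R, +oo[) (w 0%N x)%:E)%E \is a fin_num.

(** Finiteness propagates from the zeroth moment through the moment recursion. *)
Lemma integrable_laguerre_monomial j :
  leb.-integrable `]0%R, +oo[ (EFin \o w j).
Proof.
have mw := measurable_laguerre_monomial alpha j `]0%R, +oo[ (measurable_itv _).
apply/integrableP; split; first exact/measurable_EFinP.
rewrite [ltLHS](_ : _ = \int[leb]_(x in `]0%R, +oo[) `|(w j x)%:E|)%E//.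
rewrite integral_fin_num_abs//.
elim: j {mw} => [//|j IH].
by rewrite -laguerre_moment_rec// fin_numM.
Qed.

Let poly_monomialsE (p : {poly R}) : p = \sum_(i < size p) p`_i *: 'X^i.
Proof. by rewrite -[LHS]coefK poly_def. Qed.

Lemma integrable_laguerre (p : {poly R}) : leb.-integrable `]0%R, +oo[
  (EFin \o (fun x => p.[x] * (x `^ alpha * expR (- x)))).
Proof.
have mi : measurable (`]0%R, +oo[ : set R) by exact: measurable_itv.
rewrite (poly_monomialsE p); elim/big_ind: _ => [|p1 p2 i1 i2|i _].
- apply: (@eq_integrable _ _ _ leb _ mi (cst 0%E)); last exact: integrable0.
  move=> x _ /=.
  by rewrite horner0 mul0r.
- have := @integrableD _ _ _ leb _ mi _ _ i1 i2.
  apply: (@eq_integrable _ _ _ leb _ mi) => x _ /=.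
  by rewrite hornerD mulrDl.
- have := @integrableZl _ _ _ leb _ mi p`_i _ (integrable_laguerre_monomial i).
  apply: (@eq_integrable _ _ _ leb _ mi) => x _ /=.
  by rewrite hornerZ hornerXn -mulrA.
Qed.

Lemma laguerre_functional_linear : scalar (laguerre_functional alpha).
Proof.
move=> a p q.
have mi : measurable (`]0%R, +oo[ : set R) by exact: measurable_itv.
have ip := integrable_laguerre p; have iq := integrable_laguerre q.
have iap := @integrableZl _ _ _ leb _ mi a _ ip.
rewrite /laguerre_functional -RintegralZl// -RintegralD//.
by apply: eq_Rintegral => x _; rewrite hornerD hornerZ; ring.
Qed.

Lemma laguerre_functional_Xn j :
  laguerre_functional alpha 'X^(j.+1) =
  (j.+1%:R + alpha) * laguerre_functional alpha 'X^j.
Proof.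
have E i : laguerre_functional alpha 'X^i =
    fine (\int[leb]_(x in `]0%R, +oo[) (w i x)%:E)%E.
  by apply: eq_Rintegral => x _; rewrite hornerXn.
rewrite !E -laguerre_moment_rec// fineM//.
by apply: integrable_fin_num (integrable_laguerre_monomial j);
  exact: measurable_itv.
Qed.

(** By linearity it suffices to treat monomials, where this is the moment recursion. *)
Lemma laguerre_pearson (c : {scalar {poly R}}) (p : {poly R}) :
  c =1 laguerre_functional alpha ->
  c ('X * p^`()) = c ('X * p) - (alpha + 1) * c p.
Proof.
move=> cE; rewrite (poly_monomialsE p); elim/big_ind: _ => [|p1 p2 h1 h2|i _].
- by rewrite deriv0 mulr0 linear0 mulr0 subr0.
- by rewrite derivD !mulrDr !linearD /= h1 h2 mulrDr; ring.
- rewrite derivZ derivXn -!scalerAr -exprS ![c (_ *: _)]linearZ /=.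
  rewrite [c 'X^(i.+1)]cE laguerre_functional_Xn -cE.
  have -> : c ('X * ('X^(i.-1) *+ i)) = i%:R * c 'X^i.
    case: (nat_of_ord i) => [|k]; first by rewrite mulr0n mulr0 linear0 mul0r.
    by rewrite mulrnAr -exprS linearMn /= mulr_natl.
  by rewrite -natr1; ring.
Qed.

End MomentFunctional.

(** * Low-degree monic polynomials and the limit of the smallest zeros *)

Lemma monic_size1 (R : realType) (p : {poly R}) :
  p \is monic -> size p = 1%N -> p = 1.
Proof.
move=> /monicP pm sp; rewrite (size1_polyC (eq_leq sp)).
by move: pm; rewrite lead_coefE sp /= => ->.
Qed.

Lemma deriv_monic_size2 (R : realType) (p : {poly R}) :
  p \is monic -> size p = 2%N -> p^`() = 1.
Proof.
move=> /monicP pm sp.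
have sp' : (size p^`() <= 1)%N.
  by rewrite -ltnS -sp lt_size_deriv// -size_poly_gt0 sp.
rewrite (size1_polyC sp') coef_deriv.
by move: pm; rewrite lead_coefE sp /= => ->.
Qed.

Theorem mainTheorem13 (R : realType) (alpha M : R)
    (halpha : -1 < alpha) (hM : 0 <= M)
    (P T : nat -> {poly R}) (sigma mu : nat -> R)
    (hP : monic_orthogonal (laguerre_functional alpha) P)
    (hT : monic_orthogonal (laguerre_mass_functional alpha M) T)
    (hcoh : coherent P T sigma)
    (hmu : forall n : nat, (1 <= n)%N ->
       smallest_root
         (MB_poly (fun j => laguerre_functional alpha (P j ^+ 2))
                  (fun j => laguerre_mass_functional alpha M (T j ^+ 2))
                  sigma n)
         (mu n)) :
  mu n @[n --> \oo] --> (0 : R).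
Proof.
have mi : measurable (`]0%R, +oo[ : set R) by exact: measurable_itv.
have [Pmonic Pn0 _] := hP; have [Tmonic Tn0 _] := hT.
have P0 : P 0%N = 1 by apply: monic_size1; case: (Pmonic 0%N).
(* An infinite integral would give [fine +oo = 0], against [c0 (P_0 ^ 2) != 0]. *)
have weight_fin : (\int[@lebesgue_measure R]_(x in `]0%R, +oo[)
    (laguerre_monomial alpha 0 x)%:E)%E \is a fin_num.
  have := Pn0 0%N; rewrite P0 expr1n /laguerre_functional.
  under eq_Rintegral => x _ do rewrite hornerC -(expr0 x).
  by rewrite /Rintegral; case: integral => [r||] //=; rewrite eqxx.
have lin := laguerre_functional_linear alpha halpha weight_fin.
have [c cE] : exists c : {scalar {poly R}},
    (c : _ -> R) = laguerre_functional alpha.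
  pose m := GRing.isLinear.Build R {poly R} R _ (laguerre_functional alpha) lin.
  pose c : {scalar {poly R}} := HB.pack (laguerre_functional alpha) m.
  by exists c.
have [c1 c1E] : exists c1 : {scalar {poly R}},
    (c1 : _ -> R) = laguerre_mass_functional alpha M.
  have lin1 : scalar (laguerre_mass_functional alpha M).
    move=> a p q; rewrite /laguerre_mass_functional.
    by rewrite -!/(laguerre_functional alpha _) lin hornerD hornerZ; ring.
  pose m := GRing.isLinear.Build R {poly R} R _
    (laguerre_mass_functional alpha M) lin1.
  pose c1 : {scalar {poly R}} := HB.pack (laguerre_mass_functional alpha M) m.
  by exists c1.
have c_sqr_ge0 p : 0 <= c (p ^+ 2).
  rewrite cE; apply: Rintegral_ge0 => x; rewrite /= in_itv /= andbT => x0.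
  by rewrite horner_exp mulr_ge0 ?sqr_ge0// mulr_ge0 ?powR_ge0 ?expR_ge0.
have c_le_c1 p : c (p ^+ 2) <= c1 (p ^+ 2).
  rewrite cE c1E /laguerre_mass_functional -/(laguerre_functional alpha _).
  by rewrite lerDl horner_exp mulr_ge0 ?sqr_ge0.
have pearson p := laguerre_pearson alpha halpha weight_fin c p
  (fun q => f_equal (fun f => f q) cE).
rewrite -cE in hP Pn0 hmu; rewrite -c1E in hT Tn0 hmu.
have k0_gt0 n : 0 < c (P n ^+ 2) by rewrite lt0r Pn0 c_sqr_ge0.
have k1_gt0 n : 0 < c1 (T n ^+ 2).
  by rewrite lt0r Tn0; exact: le_trans (c_sqr_ge0 _) (c_le_c1 _).
pose Q n := n%:R^-1 *: (P n)^`().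
pose w n := c1 (Q n ^+ 2).
have w1 : w 1%N = c1 (T 0%N ^+ 2).
  rewrite /w /Q (monic_size1 _ (T 0%N)) ?deriv_monic_size2 ?invr1 ?scale1r//;
  by [case: (Pmonic 1%N) | case: (Tmonic 0%N)].
(* Coherence at index [n.+1] expands [Q n.+2]; the cross term vanishes because [Q n.+1] has degree
   below that of [T n.+1]. *)
have wS n : w n.+2 = c1 (T n.+1 ^+ 2) + sigma n.+1 ^+ 2 * w n.+1.
  have QE : Q n.+2 = T n.+1 + sigma n.+1 *: Q n.+1.
    by rewrite hcoh// scalerA subrK.
  have sQ : (size (Q n.+1) <= n.+1)%N.
    rewrite (leq_trans (size_scale_leq _ _))//; have [_ sP] := Pmonic n.+1.
    by rewrite -ltnS -sP lt_size_deriv// -size_poly_gt0 sP.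
  have TQ := orthogonal_lower_size c1 T _ _ hT sQ.
  have -> : w n.+2 = c1 (T n.+1 ^+ 2 + (2 * sigma n.+1) *: (T n.+1 * Q n.+1)
      + (sigma n.+1 ^+ 2) *: Q n.+1 ^+ 2).
    by rewrite /w QE -!mul_polyC; congr (c1 _); rewrite polyCM polyC_exp; ring.
  by rewrite !linearD !linearZ /= TQ mulr0 addr0.
have mu_ge0 n : 0 <= mu n.+1.
  exact: ltW (smallest_root_gt0 _ _ sigma k0_gt0 k1_gt0 mu hmu n.+1 isT).
have mu_le n : mu n.+1 <= (alpha + 1) * n.+1%:R^-1.
  have := smallest_root_mul_le _ _ sigma k0_gt0 k1_gt0 mu hmu w w1 wS n.
  have [_ sP] := Pmonic n.+1.
  have orth (q : {poly R}) : (size q <= n.+1)%N -> c (P n.+1 * q) = 0.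
    exact: orthogonal_lower_size hP.
  have dP := laguerre_deriv_norm c _ pearson _ _ sP orth.
  rewrite /w /Q exprZn [c1 (_ *: _)]linearZ /= exprVn mulrCA [leRHS]mulrC.
  rewrite ler_pM2l ?invr_gt0 ?exprn_gt0// => muP.
  (* After multiplication by [n.+1] and [c (P n.+1 ^+ 2)], the identity [dP] exposes a common factor
     [alpha + 1]; what remains follows from [c_le_c1] and [muP]. *)
  rewrite ler_pdivlMr// -(ler_pM2r (k0_gt0 n.+1)) -mulrA -dP mulrCA.
  rewrite ler_pM2l; last by rewrite -ltrBlDr sub0r.
  by apply: le_trans muP; rewrite ler_wpM2l.
rewrite -cvg_shiftS.
apply: (@squeeze_cvgr _ _ _ _ (fun=> 0) (fun n => (alpha + 1) * n.+1%:R^-1)).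
- by near=> n; rewrite mu_ge0 mu_le.
- exact: cvg_cst.
- rewrite -(mulr0 (alpha + 1)).
  by apply: cvgM; [exact: cvg_cst|exact: cvg_harmonic].
Unshelve. all: by end_near.
Qed.
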